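(* Let $n$ be a positive integer. There exists a symmetric latin cube of order $n$ if and only if either $n=1$, or $n\equiv 0,2 \pmod 3$ and $n\neq 3$.
   Context: A latin cube of order $n$ is an $n\times n\times n$ array $L=(L_{ij\ell})_{1\le i,j,\ell\le n}$ with entries from the symbol set $\{1,2,\dots,n^2\}$ such that each layer parallel to each face contains each symbol exactly once; i.e., for every $i\in\{1,\dots,n\}$, each of the three collections $\{L_{ij\ell}: 1\le j,\ell\le n\}$, $\{L_{ji\ell}: 1\le j,\ell\le n\}$, $\{L_{j\ell i}: 1\le j,\ell\le n\}$ consists of $n^2$ pairwise distinct symbols. A latin cube $L$ of order $n$ is symmetric if (1) $L_{ij\ell}=L_{j\ell i}=L_{\ell ij}$ for all pairwise distinct $i,j,\ell\in\{1,\dots,n\}$, and (2) $L_{iij}=L_{jji}$, $L_{iji}=L_{jij}$, $L_{ijj}=L_{jii}$ for all $i,j\in\{1,\dots,n\}$. *)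

(* Defs.v *)
From mathcomp Require Import all_boot.

Set Implicit Arguments.
Unset Strict Implicit.
Unset Printing Implicit Defensive.

(* Indices 1..n are shifted to 0..n-1, and symbols 1..n^2 to 0..n^2-1. *)
Definition cube (n : nat) := 'I_n -> 'I_n -> 'I_n -> 'I_(n ^ 2).

(* Each layer has n^2 cells and there are n^2 symbols, so pairwise distinct
   entries in a layer means that each symbol occurs there exactly once. *)
Definition latin_cube (n : nat) (L : cube n) : Prop :=
  forall i : 'I_n,
    [/\ injective (fun p : 'I_n * 'I_n => L i p.1 p.2),
        injective (fun p : 'I_n * 'I_n => L p.1 i p.2) &
        injective (fun p : 'I_n * 'I_n => L p.1 p.2 i)].

Definition symmetric_cube (n : nat) (L : cube n) : Prop :=
  (forall i j l : 'I_n, i <> j -> j <> l -> i <> l ->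
     L i j l = L j l i /\ L j l i = L l i j) /\
  (forall i j : 'I_n,
     [/\ L i i j = L j j i, L i j i = L j i j & L i j j = L j i i]).

(* Main.v *)
Require Import Defs.
From mathcomp Require Import all_boot zify.

(* By the symmetry conditions, the cells holding a given symbol form a partition
   of the [n] indices into points [iii], pairs (of one of three kinds [iij],
   [iji], [ijj]) and cyclically oriented triples. So a symmetric latin cube is a
   decomposition into [n ^ 2] partitions of the hypergraph on [n] points with
   every point once, every pair three times and every triple twice. By Baranyai's
   argument (extend the blocks one vertex at a time, rounding a fractional choice
   with Hall's theorem) such a decomposition exists as soon as the block sizes
   add up, which is elementary arithmetic. Conversely, if [n = 1 %[mod 3]] the
   weight [4 #points + 2 #pairs] of each partition is at least 4, while the total
   weight is [4 n + 3 n (n - 1)], forcing [n = 1]; if [n = 3] each pair needs its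
   own point, but there are 9 pairs and 3 points. *)

Set Implicit Arguments.
Unset Strict Implicit.
Unset Printing Implicit Defensive.

(** * Hall's marriage theorem and the rounding of fractional choices *)

Section Hall.
Variables (A B : finType) (r : A -> B -> bool).

Definition neighbours (X : {set A}) : {set B} :=
  [set b | [exists a in X, r a b]].

Lemma neighboursU (X Y : {set A}) :
  neighbours (X :|: Y) = neighbours X :|: neighbours Y.
Proof.
apply/setP=> b; rewrite !inE; apply/existsP/orP.
  case=> a /andP[]; rewrite inE => /orP[] aX rab; [left|right];
    by apply/existsP; exists a; rewrite aX.
by case=> /existsP[a /andP[aX rab]]; exists a; rewrite inE aX ?orbT.
Qed.

(** Induction on [#|D|], with values confined to [F] so that Hall's condition can be restated after
    deletions. A nonempty proper tight subset [X] is matched first, and the rest avoids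
    [neighbours X]. The element [b0] supplies a default value. *)
Lemma hall_in (b0 : B) (D : {set A}) (F : {set B}) :
  (forall X : {set A}, X \subset D -> #|X| <= #|neighbours X :&: F|) ->
  exists f : A -> B, {in D &, injective f} /\
    {in D, forall a, f a \in F /\ r a (f a)}.
Proof.
have [m] := ubnP #|D|; elim: m D F => // m IHm D F leDm hallD.
have [->|[a aD]] := set_0Vmem D.
  by exists (fun=> b0); split=> x; rewrite inE.
have [/existsP[X /and4P[XD X0 XnD tightX]]|] := boolP [exists X : {set A},
    [&& X \subset D, X != set0, X != D & #|neighbours X :&: F| <= #|X|]].
  have prX : X \proper D by rewrite properEneq XnD.
  have ltX : #|X| < m by have := proper_card prX; lia.
  have [|f [injf fP]] := IHm X F ltX.
    by move=> Y YX; apply/hallD/(subset_trans YX).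
  have ltDX : #|D :\: X| < m.
    have X_gt0 : 0 < #|X| by rewrite card_gt0.
    by have := cardsID X D; rewrite (setIidPr XD); lia.
  have [|g [injg gP]] := IHm (D :\: X) (F :\: neighbours X) ltDX.
    move=> Y; rewrite subsetD => /andP[YD disYX].
    have := hallD (X :|: Y); rewrite subUset XD YD => /(_ isT).
    rewrite neighboursU cardsU (disjoint_setI0 (_ : [disjoint X & Y])) 1?disjoint_sym //.
    rewrite cards0 subn0 setIUl.
    have -> : neighbours X :&: F :|: neighbours Y :&: F =
       (neighbours X :&: F) :|: (neighbours Y :&: (F :\: neighbours X)).
      apply/setP=> b; rewrite !inE.
      by case: (b \in F); case: [exists a in X, _]; case: [exists a in Y, _].
    by rewrite cardsU; lia.
  exists (fun x => if x \in X then f x else g x); split; last first.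
    move=> x xD; case: ifP => xX; first exact: fP.
    by have [|] := gP x; rewrite !inE ?xX // => /andP[].
  have fg x y : x \in X -> y \in D -> y \notin X -> f x <> g y.
    move=> xX yD yX fgxy; have [_ rfx] := fP _ xX.
    have [|] := gP y; rewrite !inE ?yX // -fgxy => /andP[/negP[]].
    by apply/existsP; exists x; rewrite xX.
  move=> x y xD yD; case: ifPn => xX; case: ifPn => yX.
  - exact: injf.
  - by move/fg => /(_ xX yD yX).
  - by move/esym/fg => /(_ yX xD xX).
  - by apply: injg; rewrite inE ?xX ?yX.
(* Every nonempty proper subset of [D] now has a spare neighbour in [F], so giving away one [b]
   preserves Hall's condition on [D :\ a]. *)
move/existsPn=> slack.
have [b] : exists b, b \in neighbours [set a] :&: F.
  by apply/card_gt0P; apply: leq_trans (hallD _ _); rewrite ?cards1 ?sub1set.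
rewrite !inE => /andP[/existsP[a' /andP[/set1P-> rab]] bF].
have [||f [injf fP]] := IHm (D :\ a) (F :\ b).
- by move: leDm; rewrite (cardsD1 a D) aD; lia.
- move=> X; rewrite subsetD1 => /andP[XD aX].
  have [->|X0] := eqVneq X set0; first by rewrite cards0.
  have := slack X; rewrite XD X0 (_ : X != D) /= -?ltnNge; last first.
    by apply: contraNneq aX => ->.
  rewrite (cardsD1 b) setIDA; lia.
exists (fun x => if x == a then b else f x); split; last first.
  move=> x xD; case: eqP => [->//|/eqP xa].
  by have [|] := fP x; rewrite !inE ?xa // => /andP[].
move=> x y xD yD; case: eqP => [->|/eqP xa]; case: eqP => [->//|/eqP ya].
- by have [|] := fP y; rewrite !inE ?ya // => /andP[/negP + _ _] => /[swap] <-.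
- by have [|] := fP x; rewrite !inE ?xa // => /andP[/negP + _ _] => /[swap] ->.
- by apply: injf; rewrite !inE ?xa ?ya.
Qed.

Lemma hall :
  (forall X : {set A}, #|X| <= #|neighbours X|) ->
  exists f : A -> B, injective f /\ forall a, r a (f a).
Proof.
move=> hallA; have [/card0_eq A0|/card_gt0P[a _]] := posnP #|A|.
  have absA (a : A) : False by have := A0 a.
  by exists (fun a => False_rect B (absA a)); split=> a; case: (absA a).
have /card_gt0P[b0 _] : 0 < #|neighbours [set a]|.
  by apply: leq_trans (hallA _); rewrite cards1.
have [|f [injf fP]] := @hall_in b0 setT setT.
  by move=> X _; rewrite setIT.
exists f; split=> [x y|x]; first exact: injf.
by case: (fP x).
Qed.

End Hall.

(** With weights [w (typ p) / N], each class has total 1 and each type [t] has total [q t]. The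
    types met by a set of classes weigh at least as much as these classes: this is Hall's condition
    for matching classes to slots, [q t] of them per type. Equal totals make the matching bijective,
    so the counts are exact. *)
Lemma assignment (P C T : finType) (cls : P -> C) (typ : P -> T)
    (w q : T -> nat) (N : nat) :
  0 < N -> (forall c, \sum_(p | cls p == c) w (typ p) = N) ->
  (forall t, #|[set p | typ p == t]| * w t = N * q t) ->
  exists g : C -> P, (forall c, cls (g c) = c) /\
    forall t, #|[set c | typ (g c) == t]| = q t.
Proof.
move=> N_gt0 cls_w typ_w.
pose r c (b : {t : T & 'I_(q t)}) :=
  [exists p, (cls p == c) && (typ p == tag b)].
have sum_cls (X : {set C}) : \sum_(p | cls p \in X) w (typ p) = N * #|X|.
  rewrite (partition_big cls (mem X)) //= mulnC -sum_nat_const.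
  apply: eq_bigr => c cX; rewrite -[RHS](cls_w c); apply: eq_bigl => p.
  by apply: andb_idl => /eqP->.
have sum_typ (Y : {set T}) :
    \sum_(p | typ p \in Y) w (typ p) = N * #|[set b : {t & 'I_(q t)} | tag b \in Y]|.
  have -> : #|[set b : {t & 'I_(q t)} | tag b \in Y]| = \sum_(t in Y) q t.
    rewrite -sum1dep_card (eq_bigr (fun t => \sum_(i < q t) 1)); last first.
      by move=> t _; rewrite sum1_card card_ord.
    by rewrite sig_big_dep /=; apply: eq_bigl => b; rewrite andbT.
  rewrite (partition_big typ (mem Y)) //= big_distrr /=.
  apply: eq_bigr => t tY; rewrite -typ_w -sum_nat_const.
  rewrite (eq_bigr (fun=> w t)) => [|p /andP[_ /eqP->//]].
  by apply: eq_bigl => p; rewrite inE; apply: andb_idl => /eqP->.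
have [X|f [injf fP]] := @hall _ _ r.
  pose Y := [set t | [exists c in X, [exists p, (cls p == c) && (typ p == t)]]].
  rewrite -(leq_pmul2l N_gt0) -sum_cls.
  have -> : neighbours r X = [set b : {t & 'I_(q t)} | tag b \in Y].
    by apply/setP=> b; rewrite !inE.
  rewrite -sum_typ; apply: sub_le_big => //= [a b|p pX]; first exact: leq_addr.
  rewrite inE; apply/existsP; exists (cls p); rewrite pX.
  by apply/existsP; exists p; rewrite !eqxx.
have bijf : bijective f.
  apply: inj_card_bij injf _; rewrite -(leq_pmul2l N_gt0) -[#|{: C}|]cardsT.
  rewrite -sum_cls [X in N * X](_ : _ = #|[set b : {t & 'I_(q t)} | tag b \in [set: T]]|).
    by rewrite -sum_typ; apply: eq_leq; apply: eq_bigl => p; rewrite !inE.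
  by apply: eq_card => b; rewrite !inE.
exists (fun c => xchoose (existsP (fP c))); split=> [c|t].
  by have /andP[/eqP] := xchooseP (existsP (fP c)).
have -> : [set c | typ (xchoose (existsP (fP c))) == t] =
    f @^-1: [set b | tag b == t].
  by apply/setP=> c; rewrite !inE; have /andP[_ /eqP->] := xchooseP (existsP (fP c)).
rewrite on_card_preimset; last exact: onW_bij.
rewrite -sum1dep_card -[RHS]card_ord -[RHS]sum1_card.
rewrite -[RHS](big_pred1_eq addn t (fun i => \sum_(j < q i) 1)) sig_big_dep /=.
by apply: eq_bigl => b; rewrite andbT.
Qed.

Section Baranyai.
Variables (P K C : finType) (kind : P -> K) (cls : P -> C).
Variables (h lam : K -> nat) (n : nat).

(** The view of a full decomposition from its first [k] vertices: [S] is the trace of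
    ['C(n - k, h t - #|S|)] sets of size [h t], each occurring [lam t] times. *)
Definition partial_decomposition (k : nat) (E : P -> {set 'I_n}) :=
  (forall (t : K) (S : {set 'I_n}), #|[set p | (kind p == t) && (E p == S)]| =
     if (S \subset [set x : 'I_n | x < k]) && (#|S| <= h t)
     then lam t * 'C(n - k, h t - #|S|) else 0) /\
  (forall c (x : 'I_n), x < k ->
     #|[set p | (cls p == c) && (x \in E p)]| = 1).

Lemma partial_decomposition_part k E p : partial_decomposition k E ->
  E p \subset [set x : 'I_n | x < k] /\ #|E p| <= h (kind p).
Proof.
case=> /(_ (kind p) (E p)) + _; case: ifP => [/andP//|_ /eqP].
by rewrite cards_eq0 => /eqP/setP/(_ p); rewrite !inE !eqxx.
Qed.

Hypothesis cls_h : forall c, \sum_(p | cls p == c) h (kind p) = n.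

(** Each of the first [k] vertices is covered once, so the current sets of a class have total size
    [k]. *)
Lemma partial_decomposition_class k E c : k <= n ->
  partial_decomposition k E ->
  \sum_(p | cls p == c) (h (kind p) - #|E p|) = n - k.
Proof.
move=> le_kn decE; have [_ cover] := decE.
rewrite sumnB => [|p _]; last by case: (partial_decomposition_part p decE).
rewrite cls_h; congr (_ - _).
rewrite (eq_bigr (fun p => \sum_(x < n) (x \in E p))) => [|p _]; last first.
  by rewrite -sum1_card big_mkcond /=; apply: eq_bigr => x _; case: ifP.
rewrite exchange_big /= -[RHS]card_ord -[RHS]sum1_card.
rewrite (big_ord_widen n (fun=> 1) le_kn) [RHS]big_mkcond /=.
apply: eq_bigr => x _; rewrite -big_mkcondr sum1dep_card /=.
case: ifPn => [/cover->//|xk]; apply/eqP; rewrite cards_eq0.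
apply/eqP/setP=> p; rewrite !inE; apply/negP=> /andP[_ xE].
have [/subsetP/(_ _ xE)] := partial_decomposition_part p decE.
by rewrite inE (negPf xk).
Qed.

(* In class [c] the part [p] is extended by the new vertex with probability
   [(h - #|E p|) / (n - k)]; by the counting identity
   [m * 'C(N, m) = N * 'C(N.-1, m.-1)] the expected number of extended parts of
   each type is an integer, and [assignment] rounds this fractional choice. *)
Lemma extend_decomposition k E : k < n -> partial_decomposition k E ->
  exists E', partial_decomposition k.+1 E'.
Proof.
move=> lt_kn decE; have [count cover] := decE.
pose x0 := Ordinal lt_kn.
pose typ p := (kind p, E p).
pose w (t : K * {set 'I_n}) := h t.1 - #|t.2|.
pose q (t : K * {set 'I_n}) :=
  if (t.2 \subset [set x : 'I_n | x < k]) && (#|t.2| < h t.1)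
  then lam t.1 * 'C((n - k).-1, (h t.1 - #|t.2|).-1) else 0.
have countE t S : #|[set p | typ p == (t, S)]| =
    #|[set p | (kind p == t) && (E p == S)]|.
  by apply: eq_card => p; rewrite !inE.
have [|c|[t S]|g [gK g_typ]] := @assignment _ _ _ cls typ w q (n - k).
- by rewrite subn_gt0.
- exact: partial_decomposition_class (ltnW lt_kn) decE.
- rewrite countE count /w /q /=; case: (S \subset _) => //=; last by rewrite muln0.
  case: ltngtP => [lt_Sh|lt_hS|->]; rewrite ?muln0 ?subnn ?muln0 //.
  have := mul_bin_diag (n - k) (h t - #|S|).-1.
  by rewrite prednK ?subn_gt0 // mulnCA => ->; rewrite mulnAC mulnA.
have g_inj : injective g := can_inj gK.
have x0E p : x0 \notin E p.
  apply/negP=> x0p; have [/subsetP/(_ _ x0p)] := partial_decomposition_part p decE.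
  by rewrite inE ltnn.
have chosen t S :
    #|[set p | [&& kind p == t, E p == S & g (cls p) == p]]| = q (t, S).
  rewrite -g_typ -(card_imset _ g_inj); apply: eq_card => p; rewrite !inE.
  apply/and3P/imsetP => [[/eqP<- /eqP<- /eqP gp]|[c]].
    by exists (cls p); rewrite ?inE ?gp.
  by rewrite inE => /eqP[<- <-] ->; rewrite gK !eqxx.
exists (fun p => if g (cls p) == p then x0 |: E p else E p); split=> [t S|c x].
  (* A set through [x0] comes exactly from the chosen parts with old set [S :\ x0], whose number is
     the quota [q]. *)
  have [x0S|x0S] := boolP (x0 \in S).
    transitivity (q (t, S :\ x0)).
      rewrite -chosen; apply: eq_card => p; rewrite !inE; congr (_ && _).
      case: ifP => _; rewrite ?andbT ?andbF; last first.
        by apply: contraNF (x0E p) => /eqP->.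
      apply/eqP/eqP => [<-|->]; last by rewrite setD1K.
      by rewrite setU1K.
    rewrite /q /= (cardsD1 x0 S) x0S add1n !subnS.
    congr (if _ && _ then _ else _).
    apply/subsetP/subsetP => sub x; rewrite ?inE.
      have [-> _|x_x0 xS] := eqVneq x x0; first exact: ltnSn.
      by have := sub x; rewrite !inE x_x0 xS => /(_ isT)/leqW.
    case/andP=> x_x0 /sub; rewrite inE ltnS leq_eqVlt => /predU1P[xk|//].
    by case/eqP: x_x0; apply: val_inj.
  (* When [x0] is not in [S], the parts with set [S] are the old ones minus the chosen ones, and the
     count follows from Pascal's rule. *)
  have := cardsID [set p | g (cls p) == p] [set p | (kind p == t) && (E p == S)].
  have -> : [set p | (kind p == t) && (E p == S)] :&: [set p | g (cls p) == p] =
      [set p | [&& kind p == t, E p == S & g (cls p) == p]].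
    by apply/setP=> p; rewrite !inE andbA.
  rewrite chosen count.
  have -> : [set p | (kind p == t) && (E p == S)] :\: [set p | g (cls p) == p] =
      [set p | (kind p == t) && ((if g (cls p) == p then x0 |: E p else E p) == S)].
    apply/setP=> p; rewrite !inE; case: ifP => //= _; apply/esym/negbTE.
    by rewrite negb_and; apply/orP; right; apply: contraNneq x0S => <-; apply: setU11.
  have -> : (S \subset [set x : 'I_n | x < k.+1]) = (S \subset [set x : 'I_n | x < k]).
    apply/subsetP/subsetP => sub x xS; have := sub x xS; rewrite !inE; last exact: leqW.
    rewrite ltnS leq_eqVlt => /predU1P[xk|//].
    by case/negP: x0S; rewrite (_ : x0 = x) //; apply: val_inj.
  rewrite /q /=; case: (S \subset _) => //=.
  case: (ltngtP #|S| (h t)) => [lt_Sh|_ //|->].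
    have -> : n - k = (n - k.+1).+1 by lia.
    have -> : h t - #|S| = (h t - #|S|).-1.+1 by lia.
    by rewrite binS /= mulnDr addnC => /addIn.
  by rewrite subnn !bin0 add0n.
rewrite ltnS leq_eqVlt => /predU1P[xk|ltxk].
  have -> : x = x0 by apply: val_inj.
  rewrite -(cards1 (g c)); apply: eq_card => p; rewrite !inE.
  case: ifP => [/eqP gp|gp]; rewrite ?setU11 ?andbT.
    by apply/eqP/eqP => [<-|->].
  rewrite (negPf (x0E p)) andbF; apply/esym/negbTE; apply: contraFneq gp => ->.
  by rewrite gK.
rewrite -(cover c x ltxk); apply: eq_card => p; rewrite !inE; congr (_ && _).
case: ifP => // _; rewrite !inE; case: eqP => // x_x0.
by move: ltxk; rewrite x_x0 ltnn.
Qed.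

Hypothesis kind_lam : forall t, #|[set p | kind p == t]| = lam t * 'C(n, h t).

(** The extension starts from empty sets, counted by [kind_lam], and ends at [k = n], where
    ['C(0, h t - #|S|)] vanishes unless [S] has full size. *)
Theorem baranyai : exists E : P -> {set 'I_n},
  (forall p, #|E p| = h (kind p)) /\
  (forall (t : K) (S : {set 'I_n}), #|S| = h t ->
     #|[set p | (kind p == t) && (E p == S)]| = lam t) /\
  (forall c x, #|[set p | (cls p == c) && (x \in E p)]| = 1).
Proof.
have [E decE] : exists E, partial_decomposition n E.
  suff ex k : k <= n -> exists E, partial_decomposition k E by apply: ex.
  elim: k => [_|k IHk lt_kn]; last first.
    by have [E /(extend_decomposition lt_kn)] := IHk (ltnW lt_kn).
  exists (fun=> set0); split=> // t S.
  rewrite (_ : [set x : 'I_n | x < 0] = set0); last by apply/setP=> x; rewrite !inE.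
  rewrite subset0 eq_sym; case: eqP => [->|_] /=.
    by rewrite cards0 !subn0 -kind_lam; apply: eq_card => p; rewrite !inE andbT.
  by apply: eq_card0 => p; rewrite !inE andbF.
have [count cover] := decE; exists E; split=> [p|]; last split=> [t S St|c x].
- have [sub le_Eh] := partial_decomposition_part p decE.
  apply/eqP; rewrite eqn_leq le_Eh leqNgt; apply/negP=> lt_Eh.
  have := count (kind p) (E p); rewrite sub le_Eh subnn bin_small ?subn_gt0 //.
  by rewrite muln0 => /eqP; rewrite cards_eq0 => /eqP/setP/(_ p); rewrite !inE !eqxx.
- rewrite count St leqnn !subnn bin0 muln1 andbT.
  by case: subsetP => // -[] x _; rewrite inE.
- exact: cover.
Qed.

End Baranyai.

(** * Cells of the cube as coloured blocks *)

Section Cells.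
Variable n : nat.
Implicit Types i j l : 'I_n.

(* The colour of a cell distinguishes the cells with the same set of indices,
   up to the identifications imposed by the symmetry conditions: it is the kind
   of a pair, or the orientation of a triple. *)
Definition colour i j l : nat :=
  if i == j then 0 else if i == l then 1 else if j == l then 2 else
  ((i < j) + (j < l) + (l < i)).-1.

Definition multiplicity (t : 'I_3) : nat := nth 0 [:: 1; 3; 2] t.

Lemma colour_lt_multiplicity i j l : exists t : 'I_3,
  #|[set i; j; l]| = t.+1 /\ colour i j l < multiplicity t.
Proof.
rewrite setUC cardsU1 cards2 !inE /colour (eq_sym l i) (eq_sym l j).
case: (eqVneq i j) => [->|ij].
  by rewrite orbb; case: (eqVneq j l) => _; [exists ord0|exists (inord 1)];
    rewrite /multiplicity ?inordK.
case: (eqVneq i l) => [_|il]; first by exists (inord 1); rewrite /multiplicity inordK.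
case: (eqVneq j l) => [_|jl]; first by exists (inord 1); rewrite /multiplicity inordK.
by exists (inord 2); rewrite /multiplicity inordK //=; lia.
Qed.

(** Stated over [nat] for the use of [lia]. Distinct indices have one or two cyclic ascents
    according to orientation; [colour] takes the predecessor. *)
Variant colour_spec (x y z : nat) : nat -> Prop :=
| ColourXX of x = y : colour_spec x y z 0
| ColourXZ of x <> y & x = z : colour_spec x y z 1
| ColourYZ of x <> y & y = z : colour_spec x y z 2
| ColourOdd of x <> y & y <> z & x <> z & (x < z < y) || (z < y < x) || (y < x < z) :
    colour_spec x y z 0
| ColourEven of (x < y < z) || (y < z < x) || (z < x < y) : colour_spec x y z 1.

Lemma colourP i j l : colour_spec i j l (colour i j l).
Proof.
rewrite /colour -!val_eqE /=; case: eqP => ij; first exact: ColourXX.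
case: eqP => il; first exact: ColourXZ.
case: eqP => jl; first exact: ColourYZ.
case: (ltngtP i j) ij => // ij _; case: (ltngtP j l) jl => // jl _; case: (ltngtP i l) il => // il _ /=;
  by [apply: ColourOdd; lia|apply: ColourEven; lia|exfalso; lia].
Qed.

(** Cells identified by symmetry differ in all three coordinates, so no layer contains two of
    them. *)
Lemma colour_inj i j l i' j' l' :
  [set i; j; l] = [set i'; j'; l'] -> colour i j l = colour i' j' l' ->
  [|| i == i', j == j' | l == l'] -> (i, j, l) = (i', j', l').
Proof.
move=> /setP eqS eq_col eq1; apply/eqP; rewrite !xpair_eqE.
have := eqS i; have := eqS j; have := eqS l.
have := eqS i'; have := eqS j'; have := eqS l'.
move: eq1 eq_col; rewrite !inE !eqxx ?orbT /= -!orbA.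
move=> + + + + + /esym/or3P lP /esym/or3P jP /esym/or3P iP.
case: iP => /eqP->; case: jP => /eqP->; case: lP => /eqP->;
  rewrite ?eqxx ?orbT ?orbF //= -!val_eqE /=;
  by case: colourP => //; case: colourP => //=; lia.
Qed.

End Cells.

(** Here [m (t, c)] is the number of blocks of size [t.+1] for the symbol [c]. Baranyai's theorem
    realises these numbers; a cell then receives the class of the part that its colour selects among
    the parts with its index set. *)
Lemma symmetric_cube_of_types n (m : 'I_3 * 'I_(n ^ 2) -> nat) : 0 < n ->
  (forall t, \sum_c m (t, c) = multiplicity t * 'C(n, t.+1)) ->
  (forall c, \sum_t m (t, c) * t.+1 = n) ->
  exists L : cube n, latin_cube L /\ symmetric_cube L.
Proof.
move=> n_gt0 sum_m sum_mh.
pose P : finType := {tc : 'I_3 * 'I_(n ^ 2) & 'I_(m tc)}.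
pose kind (p : P) := (tag p).1; pose cls (p : P) := (tag p).2.
have sumP (A : pred ('I_3 * 'I_(n ^ 2))) (F : 'I_3 * 'I_(n ^ 2) -> nat) :
    \sum_(p : P | A (tag p)) F (tag p) = \sum_(tc | A tc) m tc * F tc.
  under [RHS]eq_bigr => tc _ do rewrite -[X in X * _]card_ord -sum_nat_const.
  by rewrite sig_big_dep /=; apply: eq_bigl => p; rewrite andbT.
have [|t|E [sizeE [countE coverE]]] :=
    @baranyai P _ _ kind cls (fun t => t.+1) multiplicity n.
- move=> c; rewrite (sumP (fun tc => tc.2 == c) (fun tc => tc.1.+1)) -[RHS](sum_mh c).
  under [RHS]eq_bigr => t _ do rewrite -(big_pred1_eq addn c (fun c => m (t, c) * t.+1)).
  by rewrite pair_big /=; apply: eq_big => -[].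
- rewrite -sum1dep_card (sumP (fun tc => tc.1 == t) (fun=> 1)) -sum_m.
  rewrite -[RHS](big_pred1_eq addn t (fun t => \sum_c m (t, c))) pair_big /=.
  by apply: eq_big => -[t' c] /=; rewrite ?andbT ?muln1.
pose fibre S := enum [set p | E p == S].
pose cell i j l : {set 'I_n} := [set i; j; l].
have colour_fibre i j l : colour i j l < size (fibre (cell i j l)).
  have [t [cardS lt_t]] := colour_lt_multiplicity i j l.
  rewrite -cardE; apply: leq_trans lt_t _; rewrite -(countE t _ cardS).
  by apply: subset_leq_card; apply/subsetP=> p; rewrite !inE => /andP[].
have /card_gt0P[p0 _] : 0 < #|P|.
  have := colour_fibre (Ordinal n_gt0) (Ordinal n_gt0) (Ordinal n_gt0).
  rewrite /fibre; case: (enum _) => // p *; by apply/card_gt0P; exists p.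
pose part i j l := nth p0 (fibre (cell i j l)) (colour i j l).
have partE i j l : E (part i j l) = cell i j l.
  by have := mem_nth p0 (colour_fibre i j l); rewrite mem_enum inE => /eqP.
(* Cells in a common layer share an index, and only one part of a class contains that index. *)
have same_cell i j l i' j' l' : [|| i == i', j == j' | l == l'] ->
    cls (part i j l) = cls (part i' j' l') -> (i, j, l) = (i', j', l').
  move=> eq1 eq_cls.
  have [x xS xS'] : exists2 x, x \in cell i j l & x \in cell i' j' l'.
    by case/or3P: eq1 => /eqP eqx; [exists i|exists j|exists l];
      rewrite !inE eqx ?eqxx ?orbT.
  have eq_part : part i j l = part i' j' l'.
    have /eqP/cards1P[p eqp] := coverE (cls (part i j l)) x.
    have /set1P-> : part i j l \in [set p] by rewrite -eqp inE partE eqxx.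
    by apply/esym/set1P; rewrite -eqp inE partE eq_cls eqxx.
  have eq_cell : cell i j l = cell i' j' l' by rewrite -!partE eq_part.
  apply: (colour_inj eq_cell _ eq1); move/eqP: eq_part.
  rewrite /part eq_cell nth_uniq ?enum_uniq //; last by rewrite -eq_cell.
  by move/eqP.
have sym i j l i' j' l' : colour i j l = colour i' j' l' ->
    cell i j l = cell i' j' l' -> cls (part i j l) = cls (part i' j' l').
  by rewrite /part => -> ->.
exists (fun i j l => cls (part i j l)); split=> [i|]; first split.
- by move=> [j l] [j' l'] /= /same_cell; rewrite eqxx => /(_ isT)[-> ->].
- by move=> [j l] [j' l'] /= /same_cell; rewrite eqxx orbT => /(_ isT)[-> ->].
- by move=> [j l] [j' l'] /= /same_cell; rewrite eqxx !orbT => /(_ isT)[-> ->].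
have rot (i j l : 'I_n) : i <> j -> j <> l -> i <> l ->
    cls (part i j l) = cls (part j l i).
  move=> /eqP ij /eqP jl /eqP il; apply: sym; last first.
    by apply/setP=> x; rewrite !inE -orbA orbC.
  rewrite /colour (negPf ij) (negPf jl) (negPf il) ![_ == i]eq_sym.
  by rewrite (negPf ij) (negPf il) -addnA addnC.
split=> [i j l ij jl il|i j].
  by split; apply: rot => // /esym.
have [->|ij] := eqVneq i j; first by [].
have ji : j != i by rewrite eq_sym.
by split; apply: sym; rewrite /colour ?(negPf ij) ?(negPf ji) ?eqxx //;
  apply/setP=> x; rewrite !inE; case: (x == i); case: (x == j).
Qed.

(** The functions [a], [b], [c] count points, pairs and triples of each symbol. The total number of
    triples follows from the total size [n ^ 2 * n] of the partitions. *)
Lemma symmetric_cube_of_blocks n (a b c : nat -> nat) : 0 < n ->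
  (forall x, x < n ^ 2 -> a x + b x * 2 + c x * 3 = n) ->
  \sum_(x < n ^ 2) a x = n -> \sum_(x < n ^ 2) b x = 3 * 'C(n, 2) ->
  exists L : cube n, latin_cube L /\ symmetric_cube L.
Proof.
move=> n_gt0 abc sum_a sum_b.
have sum_c : \sum_(x < n ^ 2) c x = 2 * 'C(n, 3).
  have : \sum_(x < n ^ 2) (a x + b x * 2 + c x * 3) = n ^ 2 * n.
    rewrite (eq_bigr (fun=> n)) => [|x _]; last exact: abc.
    by rewrite sum_nat_const card_ord.
  rewrite !big_split /= -!big_distrl /= sum_a sum_b.
  have := bin_ffact n 2; have := bin_ffact n 3.
  rewrite !ffactnS !ffactn0 /= !factS fact0.
  by case: n n_gt0 {abc sum_a sum_b} => [|[|k]] //= _; nia.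
apply: (@symmetric_cube_of_types n
  (fun tx => nth 0 [:: a tx.2; b tx.2; c tx.2] tx.1)) => // [|x].
  case=> [[|[|[|//]]] lt3] /=; rewrite /multiplicity /=.
  - by rewrite sum_a bin1 mul1n.
  - exact: sum_b.
  - exact: sum_c.
by rewrite !big_ord_recr big_ord0 /= add0n muln1 abc.
Qed.

(** * Choice of block sizes for the existence direction *)

Lemma sum_interval N x y :
  y <= N -> \sum_(i < N) ((x <= i < y) : nat) = y - x.
Proof.
suff -> : \sum_(i < N) ((x <= i < y) : nat) = minn y N - x by lia.
by elim: N => [|N IHN]; rewrite ?big_ord0 ?big_ord_recr /= ?IHN; lia.
Qed.

(* Witness: if [3 %| n], [n] symbols contain one point and one pair,
   [n (3n - 5) / 6] symbols three pairs, and the others only triples; if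
   [n = 2 %[mod 3]], [n] symbols contain one point and two pairs,
   [n (n - 5) / 6] symbols four pairs, and the others one pair (the case [n = 2]
   is separate). *)
Lemma symmetric_cube_exists n : 0 < n ->
  n = 1 \/ (n = 0 %[mod 3] \/ n = 2 %[mod 3]) /\ n <> 3 ->
  exists L : cube n, latin_cube L /\ symmetric_cube L.
Proof.
move=> n_gt0 n_mod; have sqr_n : n ^ 2 = n * n by rewrite expnS expn1.
have bin2E : 'C(n, 2) * 2 + n = n * n.
  by have := bin_ffact n 2; rewrite !ffactnS ffactn0 muln1 !factS fact0 /=; nia.
have le_n : n <= n ^ 2 by rewrite sqr_n; nia.
have [->|n_neq1] := eqVneq n 1.
  by apply: (@symmetric_cube_of_blocks 1 (fun=> 1) (fun=> 0) (fun=> 0)) => //;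
    rewrite !big_ord_recr big_ord0.
have [->|n_neq2] := eqVneq n 2.
  (* Symbol 0 takes both points; the other three symbols take one pair each. *)
  apply: (@symmetric_cube_of_blocks 2 (fun x => (x == 0) * 2) (fun x => (x != 0))
    (fun=> 0)) => //; try by rewrite !big_ord_recr big_ord0.
  by case=> [|x] _.
have [n3|n_mod3] := boolP (3 %| n).
  have n_ge6 : 6 <= n by lia.
  have [z zE] : exists z, z * 6 + 5 * n = 3 * (n * n).
    by exists ('C(n, 2) - n %/ 3); nia.
  pose a x : nat := 0 <= x < n; pose s x : nat := n <= x < n + z.
  have le_z : n + z <= n ^ 2 by lia.
  apply: (@symmetric_cube_of_blocks n a (fun x => a x + s x * 3)
    (fun x => n %/ 3 - a x - s x * 2)) => //.
  - by move=> x _; rewrite /a /s; lia.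
  - by rewrite sum_interval ?subn0.
  - by rewrite big_split /= -big_distrl /= !sum_interval //; lia.
have n_ge5 : 5 <= n by lia.
have [z zE] : exists z, z * 6 + 5 * n = n * n.
  (* With [n = 3k + 5], [n (n - 5) / 6] equals [k (3k + 5) / 2], which is integral. *)
  have [k nk] : exists k, n = k * 3 + 5 by exists ((n - 5) %/ 3); lia.
  have := bin_ffact k 2; rewrite !ffactnS ffactn0 muln1 !factS fact0 /= => binkE.
  by exists (3 * 'C(k, 2) + 4 * k); rewrite nk; nia.
pose a x : nat := 0 <= x < n; pose s x : nat := n <= x < n + z.
have le_z : n + z <= n ^ 2 by lia.
apply: (@symmetric_cube_of_blocks n a (fun x => 1 + a x + s x * 3)
  (fun x => (n - 2) %/ 3 - a x - s x * 2)) => //.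
(* Four pairs require [n >= 8]; for [n = 5] no symbol has four pairs, so the truncated subtraction
   is harmless. *)
- have n_eq5 : n = 5 -> z = 0 by move=> n5; move: zE; rewrite n5; lia.
  by move=> x _; rewrite /a /s; lia.
- by rewrite sum_interval ?subn0.
- by rewrite !big_split /= -big_distrl /= !sum_interval // sum1_card card_ord; lia.
Qed.

(** Being stable under [f], the set [A] is a union of cycles of length [k]. *)
Lemma dvdn_card_fclosed (T : finType) (f : T -> T) (A : {set T}) k :
  injective f -> {in A, forall x, f x \in A /\ order f x = k} -> k %| #|A|.
Proof.
move=> injf fA; rewrite -(@fcard_order_set _ f injf k (mem A)) ?dvdn_mull //.
  by apply/subsetP=> x /fA[_ ordx]; rewrite inE ordx.
apply: intro_closed => [|x y /eqP<- /fA[]//].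
by move=> x y; apply: fconnect_sym.
Qed.

(** * Necessity, by counting the cells of each symbol *)

Section Necessity.
Variables (n : nat) (L : cube n).
Hypotheses (n_gt0 : 0 < n) (latinL : latin_cube L) (symL : symmetric_cube L).

Local Notation cell := ('I_n * ('I_n * 'I_n))%type.
Implicit Types (u : cell) (c : 'I_(n ^ 2)).

Let entry u := L u.1 u.2.1 u.2.2.
Let diagonal u := (u.1 == u.2.1) && (u.2.1 == u.2.2).
Let rainbow u := [&& u.1 != u.2.1, u.2.1 != u.2.2 & u.1 != u.2.2].
Let two_valued u := ~~ diagonal u && ~~ rainbow u.
Let count (Q : pred cell) c := #|[set u | (entry u == c) && Q u]|.

Lemma sum_count Q : \sum_c count Q c = #|[set u | Q u]|.
Proof.
rewrite -sum1dep_card (partition_big entry xpredT) //=.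
by apply: eq_bigr => c _; rewrite sum1dep_card; apply: eq_card => u; rewrite !inE andbC.
Qed.

Lemma count_predT c : count xpredT c = n.
Proof.
transitivity (\sum_i \sum_(p | L i p.1 p.2 == c) 1).
  rewrite /count -sum1dep_card pair_big_dep /=.
  by apply: eq_bigl => u; rewrite andbT.
rewrite -[RHS]card_ord -[RHS]sum1_card.
apply: eq_bigr => i _; rewrite sum1dep_card.
have [inj_i _ _] := latinL i.
have bij_i : bijective (fun p => L i p.1 p.2).
  by apply: inj_card_bij inj_i _; rewrite card_prod !card_ord expnS expn1.
rewrite -[RHS](cards1 c) -(on_card_preimset (onW_bij _ bij_i)).
by apply: eq_card => p; rewrite !inE.
Qed.

Lemma count_split c :
  count diagonal c + count two_valued c + count rainbow c = n.
Proof.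
rewrite -[RHS](count_predT c) /count -!sum1dep_card !(big_mkcond (fun u => _ && _)).
rewrite -!big_split /=; apply: eq_bigr => u _; rewrite /two_valued /diagonal /rainbow.
by case: (entry u == c); case: (u.1 == u.2.1); case: (u.2.1 == u.2.2);
  case: (u.1 == u.2.2).
Qed.

(** Rotating the coordinates preserves the entry and has cycles of length 3 on these cells. *)
Lemma rainbow_dvd3 c : 3 %| count rainbow c.
Proof.
pose rot u : cell := (u.2.1, (u.2.2, u.1)).
have rot_inj : injective rot by move=> [i [j l]] [i' [j' l']] [-> -> ->].
apply: (dvdn_card_fclosed rot_inj) => -[i [j l]].
rewrite inE => /andP[Lc /and3P[/= ij jl il]]; split.
  have [eL _] : L i j l = L j l i /\ L j l i = L l i j by apply: symL.1; apply/eqP.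
  by rewrite inE /entry /rainbow /= -eL Lc jl ![_ == i]eq_sym ij il.
apply: (@order_cycle _ rot [:: (i, (j, l)); (j, (l, i)); (l, (i, j))]).
- by rewrite /= /rot /= !eqxx.
- by rewrite /= !inE !xpair_eqE (negPf ij) (negPf il) (negPf jl).
- by rewrite inE eqxx.
Qed.

(** Exchanging the two index values is an entry-preserving involution without fixed points on these
    cells. *)
Lemma two_valued_dvd2 c : 2 %| count two_valued c.
Proof.
pose swap u : cell := let: (i, (j, l)) := u in
  if i == j then (l, (l, i)) else if i == l then (j, (i, j)) else
  if j == l then (j, (i, i)) else u.
have swapK : involutive swap.
  move=> [i [j l]]; rewrite /swap.
  have [->|ij] := eqVneq i j; first by have [->|] := eqVneq l j; rewrite ?eqxx.
  have [->|il] := eqVneq i l; first by rewrite eqxx; case: eqVneq => // ->.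
  have [->|jl] := eqVneq j l; last by rewrite (negPf ij) (negPf il) (negPf jl).
  by rewrite eqxx; case: eqVneq => // ->.
apply: (dvdn_card_fclosed (inv_inj swapK)) => u; rewrite inE => /andP[Lu tu].
have [swap_u swap_neq] : swap u \in [set u | (entry u == c) && two_valued u] /\ u != swap u.
  case: u Lu tu => i [j l]; rewrite inE /two_valued /diagonal /rainbow /entry /=.
  have [<-|ij] := eqVneq i j.
    have [-> _ _] := symL.2 i l; have [//|il] := eqVneq i l => -> _.
    by rewrite !xpair_eqE /= !eqxx [l == i]eq_sym (negPf il).
  have [<-|il] := eqVneq i l.
    have [_ -> _] := symL.2 i j => -> _.
    by rewrite !xpair_eqE /= !eqxx [j == i]eq_sym (negPf ij).
  have [<-|//] := eqVneq j l; have [_ _ ->] := symL.2 i j => -> _.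
  by rewrite !xpair_eqE /= !eqxx [j == i]eq_sym (negPf ij).
split=> //; apply: (@order_cycle _ swap [:: u; swap u]).
- by rewrite /= swapK !eqxx.
- by rewrite /= inE swap_neq.
- by rewrite inE eqxx.
Qed.

Lemma card_diagonal : #|[set u | diagonal u]| = n.
Proof.
rewrite -[RHS]card_ord -(card_imset predT (_ : injective (fun i : 'I_n => (i, (i, i))))).
  apply: eq_card => -[i [j l]]; rewrite !inE /diagonal /=.
  apply/andP/imsetP => [[/eqP-> /eqP->]|[x _ [-> -> ->]]]; by [exists l|].
by move=> x y [].
Qed.

Lemma card_two_valued : #|[set u | two_valued u]| = 3 * (n * n.-1).
Proof.
pose off := [set p : 'I_n * 'I_n | p.1 != p.2].
have card_off : #|off| = n * n.-1.
  have := cardsC off; rewrite card_prod !card_ord.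
  rewrite (_ : ~: off = [set (i, i) | i : 'I_n]); last first.
    apply/setP=> -[i j]; rewrite !inE negbK /=.
    by apply/eqP/imsetP => [->|[x _ [-> ->]]]; [exists j|].
  by rewrite card_imset => [|x y []] //; rewrite card_ord; nia.
have card_off_image (e : 'I_n * 'I_n -> cell) (Q : pred cell) : injective e ->
    (forall u, reflect (exists2 p, p \in off & u = e p) (Q u)) ->
    \sum_u (Q u : nat) = n * n.-1.
  move=> inj_e QP; rewrite -card_off -(card_imset _ inj_e) -sum1_card [RHS]big_mkcond /=.
  by apply: eq_bigr => u _; rewrite (sameP imsetP (QP u)); case: (Q u).
rewrite -sum1dep_card big_mkcond /=.
(* Split according to which two coordinates agree. *)
transitivity (\sum_(u : cell) (((u.1 == u.2.1) && (u.2.1 != u.2.2) : nat) +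
  ((u.1 == u.2.2) && (u.1 != u.2.1) : nat) + ((u.2.1 == u.2.2) && (u.1 != u.2.1) : nat))).
  apply: eq_bigr => u _; rewrite /two_valued /diagonal /rainbow.
  case: eqP => e1; case: eqP => e2; case: eqP => e3 //=; congruence.
rewrite !big_split /=.
rewrite (card_off_image (fun p : 'I_n * 'I_n => (p.1, (p.1, p.2))) (fun u : cell => (u.1 == u.2.1) && (u.2.1 != u.2.2))).
rewrite (card_off_image (fun p : 'I_n * 'I_n => (p.1, (p.2, p.1))) (fun u : cell => (u.1 == u.2.2) && (u.1 != u.2.1))).
rewrite (card_off_image (fun p : 'I_n * 'I_n => (p.1, (p.2, p.2))) (fun u : cell => (u.2.1 == u.2.2) && (u.1 != u.2.1))).
- by lia.
- by move=> [x y] [x' y'] [] *; congruence.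
- move=> [i [j l]]; apply: (iffP andP) => /= [[/eqP-> ne]|[[x y]]].
    by exists (i, l); rewrite ?inE.
  by rewrite inE => ne [-> -> ->]; rewrite eqxx.
- by move=> [x y] [x' y'] [] *; congruence.
- move=> [i [j l]]; apply: (iffP andP) => /= [[/eqP-> ne]|[[x y]]].
    by exists (l, j); rewrite ?inE.
  by rewrite inE => ne [-> -> ->]; rewrite eqxx.
- by move=> [x y] [x' y'] [] *; congruence.
- move=> [i [j l]]; apply: (iffP andP) => /= [[/eqP-> ne]|[[x y]]].
    by exists (j, l); rewrite ?inE.
  by rewrite inE => ne [-> -> ->]; rewrite eqxx.
Qed.

Lemma symmetric_cube_necessary :
  n = 1 \/ (n = 0 %[mod 3] \/ n = 2 %[mod 3]) /\ n <> 3.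
Proof.
have [/eqP n3|n_neq3] := boolP (n == 3).
  (* A pair accounts for two cells. Summed over all symbols, this bound would give [18 <= 6]. *)
  have pair_le c : count two_valued c <= 2 * count diagonal c.
    have := count_split c; rewrite n3.
    by have := rainbow_dvd3 c; have := two_valued_dvd2 c; lia.
  have := leq_sum (index_enum _) (fun c (_ : true) => pair_le c).
  by rewrite -big_distrr /= !sum_count card_diagonal card_two_valued n3.
have [n1|n_mod] := boolP (n %% 3 == 1); last by right; lia.
(* Without diagonal cells, [count two_valued c] is even and congruent to 1 modulo 3, hence at least
   4. Summation gives [4 n^2 <= 4 n + 3 n (n - 1)]. *)
have le4 c : 4 <= 4 * count diagonal c + count two_valued c.
  have := count_split c.
  by have := rainbow_dvd3 c; have := two_valued_dvd2 c; lia.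
have := leq_sum (index_enum _) (fun c (_ : true) => le4 c).
rewrite sum_nat_const card_ord big_split -big_distrr /= !sum_count.
rewrite card_diagonal card_two_valued expnS expn1 => le_n; left; nia.
Qed.

End Necessity.

Theorem theorem1p1 (n : nat) (n_gt0 : 0 < n) :
  (exists L : cube n, latin_cube L /\ symmetric_cube L) <->
  (n = 1 \/ ((n = 0 %[mod 3] \/ n = 2 %[mod 3]) /\ n <> 3)).
Proof.
split=> [[L [latinL symL]]|]; last exact: symmetric_cube_exists.
exact: symmetric_cube_necessary latinL symL.
Qed.
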